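(* The algorithm SIPP-IP is optimal: for every problem instance $(G, w, \mathrm{vel}, SI, v_{start}, t_{start}, v_{goal})$ and every admissible and consistent heuristic $h$, any trajectory returned by SIPP-IP has minimum cost among all feasible collision-free trajectories from $v_{start}$ (starting at time $t_{start}$) to $v_{goal}$, i.e. it reaches $v_{goal}$ at the earliest possible time step.
   Context: **Problem.** Time is discrete, $T=\{0,1,2,\dots\}$. An instance consists of: a directed graph $G=(V,E)$ in which each vertex has finitely many outgoing edges and each edge $e=(v,u)$ has $u\neq v$; a duration $w(e)\in\mathbb{N}$, $w(e)\ge 1$, for each edge; a velocity $\mathrm{vel}(v)\ge 0$ for each vertex (part of the agent's configuration; the agent may wait only at vertices with $\mathrm{vel}(v)=0$); for each vertex $v$ a finite sequence $SI(v)$ of pairwise disjoint intervals of time steps (safe intervals; an interval is $[a,b]=\{t\in T: a\le t\le b\}$, with $b=\infty$ allowed), any two of which are separated by at least one time step not in any of them; for each edge $e$ a finite sequence $SI(e)$ of pairwise disjoint intervals; vertices $v_{start},v_{goal}$; and a start time $t_{start}\in T$ lying in a safe interval of $v_{start}$. Write $t\in SI(x)$ if $t$ lies in some interval of $SI(x)$. A transition $(e,t)$ with $e=(v,u)$ is collision-free if $t\in SI(e)$ and $t+w(e)\in SI(u)$. A trajectory is a finite sequence $\pi=(e_1,t_1),\dots,(e_L,t_L)$ with $t_i\in T$ the starting time of the move $e_i$. It is feasible from $(v_{start},t_{start})$ to $v_{goal}$ if: the source of $e_1$ is $v_{start}$ and the target of $e_L$ is $v_{goal}$; the target of $e_i$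 equals the source of $e_{i+1}$; $t_1\ge t_{start}$ and $t_{i+1}\ge t_i+w(e_i)$; and whenever one of these inequalities is strict (i.e. the agent waits), the vertex at which the wait takes place (the source of $e_1$, resp. of $e_{i+1}$) has velocity $0$. It is collision-free if every transition $(e_i,t_i)$ is collision-free and whenever the agent waits at a vertex $v$ from time $a$ to time $b$, all time steps $a,a+1,\dots,b$ lie in $SI(v)$. Its cost is $t_L+w(e_L)$. If $v_{start}=v_{goal}$ the empty trajectory is allowed, with cost $t_{start}$. **Heuristic.** $h:V\to[0,\infty)$ with $h(v_{goal})=0$; admissible: $h(v)$ never exceeds the minimal total duration needed to travel from $v$ to $v_{goal}$; consistent: $h(v)\le w(e)+h(u)$ for every edge $e=(v,u)$. **SIPP-IP.** A search node is a pair $n=(v,[t_l,t_u])$ where $[t_l,t_u]$ is an interval ($t_u=\infty$ allowed) contained in one safe interval of $v$. Two nodes are identical iff both the vertex and the interval coincide. Its $f$-value is $f(n)=t_l+h(v)$. *Projection.* For a node $n=(v,[t_l,t_u])$ and an edge $e=(v,v')$, $\mathrm{projectIntervals}(n,e)$ returns a finite set of pairwise disjoint intervals, each contained in a safe interval of $v'$, whose union is exactly $\{t+w(e): t\in[t_l,t_u],\ (e,t)\text{ is collision-free}\}$. *Successors.* For each outgoing edge $e=(v,v')$ of $v$, compute $\mathrm{projectIntervals}(n,e)$; if $\mathrm{vel}(v')=0$, replace the upper bound of each resulting interval by the upper bound of the safe interval of $v'$ containing it; each resulting interval $ti$ gives a successor $(v',ti)$. *Main loop.* The start node is $n_{start}=(v_{start},[t_{start},t_{start}])$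 if $\mathrm{vel}(v_{start})\ne 0$, and otherwise $(v_{start},[t_{start},b])$ with $b$ the upper bound of the safe interval of $v_{start}$ containing $t_{start}$. Initially OPEN $=\{n_{start}\}$, CLOSED $=\emptyset$. While OPEN is nonempty: move a node $n$ of minimal $f$-value (ties broken arbitrarily) from OPEN to CLOSED; if the vertex of $n$ is $v_{goal}$, return the trajectory reconstructed from $n$; otherwise generate all successors of $n$, and insert into OPEN each successor that is not already in OPEN or CLOSED, recording $n$ as its parent and the edge used. If OPEN becomes empty, report failure. *Reconstruction.* Start with $n$ the extracted goal node and $t=t_l(n)$. While $n\ne n_{start}$: let $e$ be the recorded edge from the parent of $n$ to $n$; if $n$'s vertex has velocity $0$, prepend $(e,t_l(n)-w(e))$ to $\pi$ and set $t:=t_l(n)-w(e)$; otherwise prepend $(e,t-w(e))$ and set $t:=t-w(e)$; then set $n$ to its parent. If the final $t$ exceeds $t_{start}$, the agent waits at $v_{start}$ for $t-t_{start}$ steps. *)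

(* Defs.v *)
From HB Require Import structures.
From mathcomp Require Import all_boot all_order all_algebra.
From mathcomp Require Import reals.

Set Implicit Arguments.
Unset Strict Implicit.
Unset Printing Implicit Defensive.

Import Order.TTheory GRing.Theory Num.Theory.

(* The pair (a, Some b) is the interval [a, b] of time steps and (a, None) is
   [a, oo).  Intervals are understood to be nonempty, see [itv_ok]. *)
Definition itv := (nat * option nat)%type.

Definition lo (I : itv) : nat := I.1.
Definition hi (I : itv) : option nat := I.2.

Definition le_hi (b c : option nat) : bool :=
  match b, c with
  | _, None => true
  | None, Some _ => false
  | Some x, Some y => x <= y
  end.

Definition itv_ok (I : itv) : bool := le_hi (Some (lo I)) (hi I).

Definition in_itv (t : nat) (I : itv) : bool :=
  (lo I <= t) && le_hi (Some t) (hi I).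

Definition in_itvs (t : nat) (s : seq itv) : bool := has (in_itv t) s.

(* Inclusion of nonempty intervals, read off their bounds. *)
Definition sub_itv (I J : itv) : bool := (lo J <= lo I) && le_hi (hi I) (hi J).

Definition disjoint_itvs (s : seq itv) : Prop :=
  [/\ uniq s,
      all itv_ok s
    & forall I J, I \in s -> J \in s -> I != J ->
        forall t, ~~ (in_itv t I && in_itv t J)].

(* The time step t lies strictly after I and strictly before J. *)
Definition between (I : itv) (t : nat) (J : itv) : bool :=
  ~~ le_hi (Some t) (hi I) && (t < lo J).

Definition separated_itvs (s : seq itv) : Prop :=
  forall I J, I \in s -> J \in s -> I != J ->
    exists2 t, ~~ in_itvs t s & between I t J || between J t I.

(* The graph is given by adjacency lists: its edges are the pairs (v, u) with
   u \in adj v, so every vertex has finitely many outgoing edges, while the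
   vertex type V may be infinite.  The values of dur and SIe at pairs that are
   not edges are irrelevant. *)
Record instance (R : realType) (V : eqType) := Instance {
  adj : V -> seq V;
  dur : V * V -> nat;
  vel : V -> R;
  SIv : V -> seq itv;
  SIe : V * V -> seq itv;
  vstart : V;
  vgoal : V;
  tstart : nat;
  adj_uniq : forall v, uniq (adj v);
  adj_irrefl : forall v, v \notin adj v;
  dur_ge1 : forall v u, u \in adj v -> 1 <= dur (v, u);
  vel_ge0 : forall v, (0 <= vel v)%R;
  SIv_disjoint : forall v, disjoint_itvs (SIv v);
  SIv_separated : forall v, separated_itvs (SIv v);
  SIe_disjoint : forall v u, u \in adj v -> disjoint_itvs (SIe (v, u));
  tstart_safe : in_itvs tstart (SIv vstart)
}.

Section Definitions.
Variables (R : realType) (V : eqType) (G : instance R V).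

Definition is_edge (e : V * V) : bool := e.2 \in adj G e.1.

Definition transition := ((V * V) * nat)%type.

Definition collision_free_transition (m : transition) : bool :=
  in_itvs m.2 (SIe G m.1) && in_itvs (m.2 + dur G m.1) (SIv G m.1.2).

(* The empty list is the empty trajectory; waits are implicit in the gaps
   between an arrival and the next starting time. *)
Definition trajectory := seq transition.

(* The agent is at v at time t, and still has to perform the moves of pi. *)
Fixpoint feasible_from (v : V) (t : nat) (pi : trajectory) : Prop :=
  match pi with
  | [::] => v = vgoal G
  | (e, s) :: pi' =>
      [/\ is_edge e, e.1 = v, t <= s, t < s -> vel G v = 0%R
        & feasible_from e.2 (s + dur G e) pi']
  end.

Fixpoint collision_free_from (v : V) (t : nat) (pi : trajectory) : Prop :=
  match pi with
  | [::] => True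
  | (e, s) :: pi' =>
      [/\ t < s -> forall k, t <= k <= s -> in_itvs k (SIv G v),
          collision_free_transition (e, s)
        & collision_free_from e.2 (s + dur G e) pi']
  end.

Definition feasible (pi : trajectory) : Prop :=
  feasible_from (vstart G) (tstart G) pi.

Definition collision_free (pi : trajectory) : Prop :=
  collision_free_from (vstart G) (tstart G) pi.

Definition cost (pi : trajectory) : nat :=
  last (tstart G) [seq m.2 + dur G m.1 | m <- pi].

Fixpoint walk_dur (v : V) (p : seq V) : nat :=
  if p is u :: p' then dur G (v, u) + walk_dur u p' else 0.

Definition admissible (h : V -> R) : Prop :=
  forall v p, path (fun x y => y \in adj G x) v p -> last v p = vgoal G ->
    (h v <= (walk_dur v p)%:R)%R.

Definition consistent (h : V -> R) : Prop :=
  forall v u, u \in adj G v -> (h v <= (dur G (v, u))%:R + h u)%R.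

Definition heuristic (h : V -> R) : Prop :=
  (forall v, (0 <= h v)%R) /\ h (vgoal G) = 0%R.

Definition node := (V * itv)%type.

Definition is_node (n : node) : bool :=
  itv_ok n.2 && has (sub_itv n.2) (SIv G n.1).

Definition fval (h : V -> R) (n : node) : R := ((lo n.2)%:R + h n.1)%R.

(* projectIntervals is any function meeting this specification; the finite set
   of intervals is returned as a duplicate-free list in arbitrary order. *)
Definition is_projection (proj : node -> V * V -> seq itv) : Prop :=
  forall (n : node) (e : V * V), is_node n -> is_edge e -> e.1 = n.1 ->
    [/\ disjoint_itvs (proj n e),
        forall I, I \in proj n e -> has (sub_itv I) (SIv G e.2)
      & forall s, in_itvs s (proj n e) <->
          exists t, [/\ in_itv t n.2, collision_free_transition (e, t)
                      & s = t + dur G e]].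

(* When the agent can wait at v, the upper bound of I becomes that of the safe
   interval of v containing I, which is unique as I is nonempty. *)
Definition extend_if_wait (v : V) (I : itv) : itv :=
  if vel G v == 0%R then
    if [seq J <- SIv G v | sub_itv I J] is J :: _ then (lo I, hi J) else I
  else I.

Definition start_node : node :=
  (vstart G, extend_if_wait (vstart G) (tstart G, Some (tstart G))).

Definition successors (proj : node -> V * V -> seq itv) (n : node) :
    seq ((V * V) * node) :=
  [seq ((n.1, u), (u, extend_if_wait u ti)) | u <- adj G n.1,
                                             ti <- proj n (n.1, u)].

Record state := State {
  open : seq node;
  closed : seq node;
  parent : node -> option (node * (V * V))
}.

Definition init_state : state := State [:: start_node] [::] (fun=> None).

Definition close (n : node) (st : state) : state :=
  State (rem n (open st)) (n :: closed st) (parent st).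

Definition insert (n : node) (st : state) (em : (V * V) * node) : state :=
  let: (e, m) := em in
  if (m \in open st) || (m \in closed st) then st
  else State (m :: open st) (closed st)
             (fun x => if x == m then Some (n, e) else parent st x).

Definition expand (proj : node -> V * V -> seq itv) (n : node) (st : state) :
    state :=
  foldl (insert n) (close n st) (successors proj n).

(* Any node satisfying this may be extracted: ties are broken arbitrarily. *)
Definition min_open (h : V -> R) (st : state) (n : node) : Prop :=
  n \in open st /\ forall m, m \in open st -> (fval h n <= fval h m)%R.

(* The states in which the loop condition of some execution is evaluated. *)
Inductive reachable (proj : node -> V * V -> seq itv) (h : V -> R) :
    state -> Prop :=
| reachable_init : reachable proj h init_state
| reachable_expand st n :
    reachable proj h st -> min_open h st n -> n.1 <> vgoal G ->
    reachable proj h (expand proj n st).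

(* [reconstruct par n t acc pi]: the reconstruction loop, when at node n with
   current time t and list of moves acc, ends with the list of moves pi.  The
   final wait at the start vertex is implicit in the first starting time of pi.
   In actual runs every move arrives at a time at least its duration, so the
   subtractions below are never truncated. *)
Inductive reconstruct (par : node -> option (node * (V * V))) :
    node -> nat -> trajectory -> trajectory -> Prop :=
| reconstruct_start t acc : reconstruct par start_node t acc acc
| reconstruct_step n m e t acc pi :
    n <> start_node -> par n = Some (m, e) ->
    let t' := (if vel G n.1 == 0%R then lo n.2 else t) - dur G e in
    reconstruct par m t' ((e, t') :: acc) pi ->
    reconstruct par n t acc pi.

Definition sipp_ip_returns (proj : node -> V * V -> seq itv) (h : V -> R)
    (pi : trajectory) : Prop :=
  exists st n, [/\ reachable proj h st, min_open h st n, n.1 = vgoal G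
                 & reconstruct (parent (close n st)) n (lo n.2) [::] pi].

Definition optimal (pi : trajectory) : Prop :=
  [/\ feasible pi, collision_free pi
    & forall pi', feasible pi' -> collision_free pi' -> cost pi <= cost pi'].

End Definitions.

(* Main.v *)
(* Call a node canonical if its interval lies in a safe interval J of its vertex
   and, when waiting is possible there, ends where J ends.  The search only
   generates canonical nodes, and every node on a chain of parents can be
   crossed by an agent arriving at any admissible time of its interval, so the
   reconstruction is a valid trajectory arriving at the lower bound of the goal
   node.  Conversely, given a valid trajectory, follow the generated nodes whose
   intervals contain its successive arrival times: as no goal node has been
   closed, one of them is still open, and admissibility bounds its f-value by
   the cost of the trajectory.  The extracted goal node has minimal f-value,
   which is the cost of the returned trajectory. *)
Require Import Defs.
From HB Require Import structures.
From mathcomp Require Import all_boot all_order all_algebra.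
From mathcomp Require Import reals.
(* Restores the in_itv of Defs, shadowed by that of mathcomp intervals. *)
Import Defs.

Set Implicit Arguments.
Unset Strict Implicit.
Unset Printing Implicit Defensive.

Import Order.TTheory GRing.Theory Num.Theory.

(** * Intervals of time steps *)

Lemma le_hi_trans b a c : le_hi a b -> le_hi b c -> le_hi a c.
Proof. by case: a b c => [a|] [b|] [c|] //=; apply: leq_trans. Qed.

Lemma in_itv_sub t I J : sub_itv I J -> in_itv t I -> in_itv t J.
Proof.
move=> /andP[loJI hiIJ] /andP[loIt tI]; rewrite /in_itv.
by rewrite (leq_trans loJI loIt) (le_hi_trans tI hiIJ).
Qed.

Lemma in_itv_convex a b k I :
  in_itv a I -> in_itv b I -> a <= k <= b -> in_itv k I.
Proof.
move=> /andP[loa _] /andP[_ bhi] /andP[ak kb].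
by rewrite /in_itv (leq_trans loa ak) (@le_hi_trans (Some b)).
Qed.

Lemma lo_in_itv I : itv_ok I -> in_itv (lo I) I.
Proof. by rewrite /in_itv leqnn. Qed.

(** If [b] lay in another interval of [s], the time step outside [s] that separates it from [I]
    would fall between [a] and [b]. *)
Lemma separated_itvs_convex s I a b :
  separated_itvs s -> I \in s -> in_itv a I -> a <= b ->
  (forall k, a <= k <= b -> in_itvs k s) -> in_itv b I.
Proof.
move=> sep Is aI ab safe.
have /hasP[J Js bJ] : in_itvs b s by apply: safe; rewrite ab leqnn.
have [<- //|neIJ] := eqVneq J I.
rewrite eq_sym in neIJ; have [k kNs] := sep I J Is Js neIJ.
case/andP: aI bJ => loIa aI /andP[loJb bJ].
case/orP => /andP[kNhi kLlo]; case/negP: kNs.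
  apply: safe; rewrite (leq_trans (ltnW kLlo) loJb) andbT leqNgt.
  apply: contra kNhi => ka; apply: le_hi_trans aI; exact: ltnW.
(* Here [J] would precede [I]: [k] lies beyond the end of [J], although [k < lo I <= a <= b] and [b]
   is in [J]. *)
case/negP: kNhi; apply: le_hi_trans bJ => /=.
exact: leq_trans (ltnW kLlo) (leq_trans loIa ab).
Qed.

Section Optimality.
Variables (R : realType) (V : eqType) (G : instance R V).
Implicit Types (n m x : node V) (e : V * V) (st : state V) (pi : trajectory V).

(** * Canonical nodes and waiting *)

Definition canonical n : Prop :=
  itv_ok n.2 /\ exists J, [/\ J \in SIv G n.1, sub_itv n.2 J
                            & vel G n.1 = 0%R -> hi n.2 = hi J].

Lemma canonical_is_node n : canonical n -> is_node G n.
Proof. by case=> ok [J [Js sub _]]; rewrite /is_node ok; apply/hasP; exists J. Qed.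

Lemma canonical_extend_if_wait v I :
  itv_ok I -> has (sub_itv I) (SIv G v) -> canonical (v, extend_if_wait G v I).
Proof.
move=> ok hasI; rewrite /extend_if_wait; case: eqP => [vel0|velN0]; last first.
  by split=> //; case/hasP: hasI => J Js sub; exists J; split.
case flt: [seq J <- SIv G v | sub_itv I J] => [|J s].
  by move: hasI; rewrite has_filter flt.
have: J \in [seq J <- SIv G v | sub_itv I J] by rewrite flt mem_head.
rewrite mem_filter => /andP[/andP[loJI hiIJ] Js].
split; first exact: le_hi_trans ok hiIJ.
exists J; split=> //=; rewrite /sub_itv /= loJI /=.
by case: (hi J) => //=.
Qed.

Lemma lo_extend_if_wait v I : lo (extend_if_wait G v I) = lo I.
Proof. by rewrite /extend_if_wait; case: ifP => // _; case: filter. Qed.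

Lemma extend_if_wait_sub v I t : in_itv t I -> in_itv t (extend_if_wait G v I).
Proof.
rewrite /extend_if_wait; case: ifP => // _.
case flt: [seq J <- SIv G v | sub_itv I J] => [|J s] // tI.
have: J \in [seq J <- SIv G v | sub_itv I J] by rewrite flt mem_head.
rewrite mem_filter => /andP[sub _].
by have /andP[_ tJ] := in_itv_sub sub tI; case/andP: tI => loI _; apply/andP.
Qed.

Lemma extend_if_wait_id v I : vel G v <> 0%R -> extend_if_wait G v I = I.
Proof. by rewrite /extend_if_wait => /eqP/negbTE ->. Qed.

Lemma canonical_start_node : canonical (start_node G).
Proof.
apply: (@canonical_extend_if_wait (vstart G) (tstart G, Some (tstart G))).
  exact: leqnn.
exact: tstart_safe.
Qed.

Lemma tstart_in_start_node : in_itv (tstart G) (start_node G).2.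
Proof. by apply: extend_if_wait_sub; rewrite /in_itv /= leqnn. Qed.

(** Separation keeps an uninterrupted safe wait inside the safe interval around [n], and zero
    velocity makes [n] last until the end of that interval. *)
Lemma canonical_wait n t s :
  canonical n -> in_itv t n.2 -> t <= s -> (t < s -> vel G n.1 = 0%R) ->
  (t < s -> forall k, t <= k <= s -> in_itvs k (SIv G n.1)) -> in_itv s n.2.
Proof.
case=> _ [J [Js sub hiJ]] tn; rewrite leq_eqVlt => /predU1P[<- // | ts] vel0 safe.
have /andP[_ sJ] : in_itv s J.
  apply: separated_itvs_convex (in_itv_sub sub tn) (ltnW ts) (safe ts) => //.
  exact: SIv_separated.
by case/andP: tn => lot _; rewrite /in_itv (leq_trans lot (ltnW ts)) hiJ ?vel0.
Qed.

Lemma canonical_safe n k : canonical n -> in_itv k n.2 -> in_itvs k (SIv G n.1).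
Proof.
by case=> _ [J [Js sub _]] kn; apply/hasP; exists J => //; apply: in_itv_sub kn.
Qed.

(** * Arrival times and admissibility *)

Definition arrivals pi : seq nat := [seq p.2 + dur G p.1 | p <- pi].

Lemma admissible_last_arrival (h : V -> R) v t pi :
  admissible G h -> feasible_from G v t pi ->
  (t%:R + h v <= (last t (arrivals pi))%:R :> R)%R.
Proof.
move=> adm feas.
pose p := [seq q.1.2 | q <- pi].
suff [pathp lastp bound]: [/\ path (fun u w => w \in adj G u) v p,
    last v p = vgoal G & t + walk_dur G v p <= last t (arrivals pi)].
  apply: (@le_trans _ _ (t + walk_dur G v p)%N%:R%R); last by rewrite ler_nat.
  by rewrite natrD lerD2l adm.
rewrite {}/p; elim: pi v t feas => [|[[v' u] s] pi IH] v t /=.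
  by move=> ->; rewrite addn0.
case=> edge /= <- ts _ /IH[pathp lastp bound]; split=> //.
  by apply/andP; split.
by apply: leq_trans bound; rewrite addnA !leq_add2r.
Qed.

(** * Successors and projected intervals *)

Variable proj : node V -> V * V -> seq itv.
Hypothesis projP : is_projection G proj.

Lemma successorsP n e x : is_node G n -> (e, x) \in successors G proj n ->
  exists I, [/\ [/\ is_edge G e, e.1 = n.1 & e.2 = x.1], I \in proj n e,
                itv_ok I, has (sub_itv I) (SIv G x.1)
              & x.2 = extend_if_wait G x.1 I].
Proof.
move=> nn /allpairsPdep[u [I [uadj Iproj [-> ->]]]]; exists I.
have [[_ /allP ok _] safe _] := projP nn (uadj : is_edge G (n.1, u)) erefl.
by split; rewrite ?ok ?safe.
Qed.

Lemma canonical_successor n e x :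
  is_node G n -> (e, x) \in successors G proj n -> canonical x.
Proof.
move=> nn /(successorsP nn)[I [_ _ ok safe]]; case: x safe => v J /= safe ->.
exact: canonical_extend_if_wait.
Qed.

(** Extension may add times at which no move from [n] arrives. Where waiting is possible, only the
    lower bound is sure to come from the projection, so [a] is pinned to it. *)
Lemma successor_departure n e x a :
  is_node G n -> (e, x) \in successors G proj n ->
  in_itv a x.2 -> (vel G x.1 = 0%R -> a = lo x.2) ->
  [/\ dur G e <= a, in_itv (a - dur G e) n.2
    & collision_free_transition G (e, a - dur G e)].
Proof.
move=> nn /(successorsP nn)[I [[edge src tgt] Iproj ok safe xI]] ax alo.
have [_ _ projE] := projP nn edge src.
have /projE[t [tn cf ->]] : in_itvs a (proj n e).
  apply/hasP; exists I => //; have [vel0|velN0] := eqVneq (vel G x.1) 0%R.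
    by rewrite alo // xI lo_extend_if_wait lo_in_itv.
  by move: ax; rewrite xI extend_if_wait_id //; apply/eqP.
by rewrite addnK leq_addl.
Qed.

Lemma successor_arrival n e s :
  is_node G n -> is_edge G e -> e.1 = n.1 -> in_itv s n.2 ->
  collision_free_transition G (e, s) ->
  exists x, [/\ (e, x) \in successors G proj n, x.1 = e.2
              & in_itv (s + dur G e) x.2].
Proof.
case: e => v u nn edge /= vn sn cf; rewrite {v}vn in edge cf *.
have [_ _ projE] := projP nn edge erefl.
have /hasP[I Iproj sI] : in_itvs (s + dur G (n.1, u)) (proj n (n.1, u)).
  by apply/projE; exists s.
exists (u, extend_if_wait G u I); split=> //; last exact: extend_if_wait_sub.
by apply/allpairsPdep; exists u, I.
Qed.

(** * Invariant of the search *)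

Definition generated st x := (x \in open st) || (x \in closed st).

Lemma generated_close st n x :
  n \in open st -> generated (close n st) x = generated st x.
Proof.
move=> nopen; rewrite /generated /= inE.
have [->|xn] := eqVneq x n; first by rewrite orbT nopen.
have -> // : (x \in rem n (open st)) = (x \in open st).
by apply/idP/idP => [/mem_rem //|]; exact: rem_mem.
Qed.

Lemma insertsP n st s (st' := foldl (insert n) st s) :
  [/\ closed st' = closed st,
      forall x, generated st' x = generated st x || (x \in unzip2 s)
    & forall x p, parent st' x = Some p ->
        parent st x = Some p \/ p.1 = n /\ (p.2, x) \in s].
Proof.
rewrite {}/st'; elim: s st => [|[e m] s IH] st /=.
  by split=> // [x|x p ->]; [rewrite orbF | left].
have [-> gen par] := IH (insert n st (e, m)); split.
- by rewrite /=; case: ifP.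
- move=> x; rewrite gen inE orbA; congr (_ || _).
  rewrite /insert -/(generated st m); case: ifP => [gm|_].
    by case: eqP => [->|]; rewrite ?gm ?orbF.
  by rewrite /generated /= inE -orbA orbC.
move=> x p /par[|[pn ps]]; last by right; rewrite inE ps orbT.
rewrite /insert; case: ifP => _; first by left.
rewrite /=; case: eqP => [-> [<-]|_]; last by left.
by right; rewrite mem_head.
Qed.

(** The clause on closed nodes lets a trajectory be followed past them; the clause on parents makes
    each chain of parents a chain of possible moves. *)
Definition search_invariant st : Prop :=
  [/\ generated st (start_node G),
      forall x, generated st x -> canonical x,
      forall n, n \in closed st ->
        n.1 <> vgoal G /\
        forall e x, (e, x) \in successors G proj n -> generated st x
    & forall x m e, parent st x = Some (m, e) ->
        canonical m /\ (e, x) \in successors G proj m].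

Lemma reachable_invariant h st :
  reachable G proj h st -> search_invariant st.
Proof.
elim=> [|{}st n _ [start can clos par] [nopen _] ngoal].
  rewrite /search_invariant /generated; split=> //=; first by rewrite mem_head.
  by move=> x; rewrite inE in_nil orbF => /eqP ->; exact: canonical_start_node.
have cann : canonical n by apply: can; rewrite /generated nopen.
have [closE gen par'] := insertsP n (close n st) (successors G proj n).
rewrite -/(expand G proj n st) in closE gen par'.
have genE x : generated (expand G proj n st) x =
    generated st x || (x \in unzip2 (successors G proj n)).
  by rewrite gen generated_close.
split.
- by rewrite genE start.
- move=> x; rewrite genE => /orP[/can //|/mapP[[e m] succ ->]].
  exact: canonical_successor (canonical_is_node cann) succ.
- move=> m; rewrite closE inE => /predU1P[->|/clos[mgoal succ]]; split=> // e x.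
    by move=> ex; rewrite genE (map_f snd ex) orbT.
  by move=> /succ gx; rewrite genE gx.
by move=> x m e /par'[/par //|[/= -> ex]].
Qed.

(** Induction on the moves: an open [n] is the witness, and a closed one has a generated successor
    containing the next arrival. With no move left, a closed [n] would be a closed goal node. *)
Lemma open_fval_le h st n t pi :
  admissible G h -> search_invariant st ->
  generated st n -> in_itv t n.2 ->
  feasible_from G n.1 t pi -> collision_free_from G n.1 t pi ->
  exists2 m, m \in open st & (fval h m <= (last t (arrivals pi))%:R)%R.
Proof.
move=> adm [_ can clos _].
elim: pi n t => [|[e s] pi IH] n t gn tn feas cf; case/orP: (gn).
- move=> nopen; exists n => //.
  apply: le_trans (admissible_last_arrival adm feas).
  by rewrite lerD2r ler_nat; case/andP: tn.
- by case/clos => ngoal; case: ngoal.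
- move=> nopen; exists n => //.
  apply: le_trans (admissible_last_arrival adm feas).
  by rewrite lerD2r ler_nat; case/andP: tn.
case/clos => _ succ.
case: feas cf => edge src ts wait feas [safe cfes cf].
have cann := can n gn.
have sn := canonical_wait cann tn ts wait safe.
have [x [ex xe sx]] :=
  successor_arrival (canonical_is_node cann) edge src sn cfes.
by apply: (IH x) => //; rewrite ?xe //; exact: succ ex.
Qed.

(** * Validity of the reconstructed trajectory *)

(* An agent that arrives at n at time a, waits there until t if allowed, and
   then performs the moves acc, reaches the goal safely at time c. *)
Definition completes c n t (acc : trajectory V) : Prop :=
  forall a, in_itv a n.2 -> a <= t -> (a < t -> vel G n.1 = 0%R) ->
  [/\ feasible_from G n.1 a acc, collision_free_from G n.1 a acc
    & last a (arrivals acc) = c].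

(** Where waiting is possible the move aims at the earliest arrival [lo n.2] and the agent then
    waits until [t]; elsewhere it must arrive exactly at [t]. *)
Lemma completes_parent c n t acc m e
    (a := if vel G n.1 == 0%R then lo n.2 else t) :
  canonical m -> (e, n) \in successors G proj m ->
  in_itv t n.2 -> completes c n t acc ->
  in_itv (a - dur G e) m.2 /\
  completes c m (a - dur G e) ((e, a - dur G e) :: acc).
Proof.
move=> canm en tn compl; have nodem := canonical_is_node canm.
have [I [[edge src tgt] _ _ _ _]] := successorsP nodem en.
have [okn _] := canonical_successor nodem en.
have an : in_itv a n.2 by rewrite /a; case: ifP => // _; exact: lo_in_itv.
have alo : vel G n.1 = 0%R -> a = lo n.2 by rewrite /a => ->; rewrite eqxx.
have [da a'm cf] := successor_departure nodem en an alo.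
split=> // b bm ba wait; rewrite /= subnK // tgt.
have [] := compl a an; rewrite ?/a.
- by case: ifP => // _; case/andP: tn.
- by case: eqP; rewrite ?ltnn.
(* A wait at [m] is safe because both of its ends lie in the interval of [m]. *)
by split=> //; split=> // _ k /(in_itv_convex bm a'm); exact: canonical_safe.
Qed.

Lemma reconstruct_completes c par n t acc pi :
  (forall x m e, par x = Some (m, e) ->
     canonical m /\ (e, x) \in successors G proj m) ->
  reconstruct G par n t acc pi -> in_itv t n.2 -> completes c n t acc ->
  [/\ feasible G pi, collision_free G pi & cost G pi = c].
Proof.
move=> parP; elim=> [{}t {}acc ts compl | {}n m e {}t {}acc {}pi _].
  have lo_start : lo (start_node G).2 = tstart G by rewrite lo_extend_if_wait.
  apply: compl tstart_in_start_node _ _; first by case/andP: ts; rewrite lo_start.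
  (* If waiting is impossible at the start, the start interval is the single time [tstart G], so no
     wait arises. *)
  case: (eqVneq (vel G (vstart G)) 0%R) => // /eqP velN0; move: ts.
  by rewrite /= extend_if_wait_id // => /andP[_ /= tle]; rewrite ltnNge tle.
move=> /parP[canm en] t' _ IH tn compl.
by have [t'm compl'] := completes_parent canm en tn compl; apply: IH.
Qed.

End Optimality.

Theorem theorem2 (R : realType) (V : eqType) (G : instance R V)
    (proj : node V -> V * V -> seq itv) (h : V -> R)
    (pi : trajectory V) :
  is_projection G proj ->
  heuristic G h -> admissible G h -> consistent G h ->
  sipp_ip_returns G proj h pi ->
  optimal G pi.
Proof.
move=> projP [_ hgoal] adm _ [st [n [reach [nopen nmin] ngoal rec]]].
have inv := reachable_invariant projP reach.
have [start can _ par] := inv.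
have [okn _] : canonical G n by apply: can; rewrite /generated nopen.
have [||feas cf costE] := reconstruct_completes (c := lo n.2) projP par rec.
- exact: lo_in_itv.
(* With no moves left, the agent must be at the goal at exactly [lo n.2]. *)
- by move=> a /andP[loa _] alo _; split=> //; apply/eqP; rewrite eqn_leq alo.
split=> // pi' feas' cf'; rewrite costE -(ler_nat R).
have [m mopen mle] :=
  open_fval_le projP adm inv start (tstart_in_start_node G) feas' cf'.
by apply: le_trans mle; apply: le_trans (nmin m mopen); rewrite /fval ngoal hgoal addr0.
Qed.
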